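(* Let $(T,X)$ be a syndetically transitive semiflow on a compact Hausdorff space $X$ with $T$ a right C-semigroup. If $(T,X)$ is weakly almost periodic, then it is minimal and equicontinuous.
   Context: $X$ is a compact Hausdorff space with its (symmetric) uniform structure $\mathscr{U}_X$. A semiflow $(T,X)$ consists of a topological semigroup $T$ with neutral element $e$ and a jointly continuous map $T\times X\to X$, $(t,x)\mapsto tx$, with $ex=x$ and $(ts)x=t(sx)$ for all $s,t\in T$, $x\in X$. A topological semigroup $T$ is a right C-semigroup if for every $s\in T$ the set $T\setminus Ts$ is relatively compact in $T$. A subset $A\subseteq T$ is syndetic if there is a compact $K\subseteq T$ with $Kt\cap A\neq\emptyset$ for every $t\in T$. $(T,X)$ is syndetically transitive if $\{t\in T: U\cap t^{-1}V\neq\emptyset\}$ is syndetic in $T$ for all non-empty open subsets $U,V$ of $X$, where $t^{-1}V=\{x\in X: tx\in V\}$. $(T,X)$ is weakly almost periodic if for every $f\in C(X,\mathbb{R})$ the set $Tf=\{f_t : t\in T\}$, where $f_t(x)=f(tx)$, is relatively compact in $C(X,\mathbb{R})$ with the topology of pointwise convergence. $(T,X)$ is minimal if every orbit $Tx=\{tx:t\in T\}$, $x\in X$, is dense in $X$. $(T,X)$ is equicontinuous if for every $\varepsilon\in\mathscr{U}_X$ there is $\delta\in\mathscr{U}_X$ such that $(x,y)\in\delta$ implies $(tx,ty)\in\varepsilon$ for all $t\in T$. *)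

(* Defs.v *)
From HB Require Import structures.
From mathcomp Require Import all_boot all_order all_algebra.
From mathcomp Require Import all_classical all_reals all_analysis.

Set Implicit Arguments.
Unset Strict Implicit.
Unset Printing Implicit Defensive.

Import numFieldNormedType.Exports.
(* With this import, [continuousType X Y] has the topology of pointwise
   convergence. *)
Import ArrowAsProduct.

Local Open Scope classical_set_scope.

HB.mixin Record Topological_Monoid_isTopMonoid T & Topological T & Monoid T := {
  mulg_continuous : continuous (fun st : T * T => (st.1 * st.2)%g)
}.

#[short(type="topMonoidType")]
HB.structure Definition TopMonoid :=
  {T of Topological T & Monoid T & Topological_Monoid_isTopMonoid T}.

Record semiflow (T : topMonoidType) (X : topologicalType) := Semiflow {
  act :> T -> X -> X;
  act_continuous : continuous (fun tx : T * X => act tx.1 tx.2);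
  act1 : forall x, act 1%g x = x;
  actM : forall s t x, act (t * s)%g x = act t (act s x)
}.

Section SemiflowContinuous.
Context (T : topMonoidType) (X : topologicalType) (phi : semiflow T X) (t : T).

Lemma act_continuousr : continuous (phi t).
Proof.
move=> x; apply: (@continuous_comp _ _ _ (pair t)
  (fun tx : T * X => phi tx.1 tx.2)); last exact: act_continuous.
by apply: cvg_pair; [exact: cvg_cst | exact: cvg_id].
Qed.

HB.instance Definition _ := isContinuous.Build X X (phi t) act_continuousr.

End SemiflowContinuous.

Definition right_C_semigroup (T : topMonoidType) :=
  forall s : T, precompact (~` [set (t * s)%g | t in [set: T]]).

Definition syndetic (T : topMonoidType) (A : set T) :=
  exists2 K : set T, compact K &
    forall t, [set (k * t)%g | k in K] `&` A !=set0.

Section SemiflowProperties.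
Context (T : topMonoidType).

Definition syndetically_transitive (X : topologicalType) (phi : semiflow T X) :=
  forall U V : set X, open U -> U !=set0 -> open V -> V !=set0 ->
    syndetic [set t | U `&` phi t @^-1` V !=set0].

Definition weakly_almost_periodic (R : realType) (X : topologicalType)
    (phi : semiflow T X) :=
  forall f : continuousType X R,
    precompact [set (f \o phi t : continuousType X R) | t in [set: T]].

Definition minimal (X : topologicalType) (phi : semiflow T X) :=
  forall x, dense [set phi t x | t in [set: T]].

Definition uniformly_equicontinuous (X : uniformType) (phi : semiflow T X) :=
  forall E : set (X * X), entourage E ->
    exists2 D : set (X * X), entourage D &
      forall x y, D (x, y) -> forall t, E (phi t x, phi t y).

End SemiflowProperties.

Arguments weakly_almost_periodic {T} R {X} phi.

(* Main.v *)
(* A Namioka-type argument: if a pointwise compact set K of continuous functions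
   on a compact space were nowhere e-equicontinuous inside U, one could choose
   decreasing open sets V_n, points a_n of V_n and functions f_n, g_n of K that
   nearly agree at a_0, ..., a_(n-1) but differ by more than e on V_(n+1).
   A cluster point (a, f, g) would satisfy f = g at every a_n, hence at a, and
   |f(a) - g(a)| >= e.  So weak almost periodicity gives, for every f and e,
   nonempty open sets U all of whose translates tU have f-oscillation at most e.
   Such a U turns syndetic transitivity into: for every t some k in a fixed
   compact K maps all of tU into a given open V.  Since TU is dense, every orbit
   meets V.  By minimality every x is mapped into such a U by some s, which
   controls the translations in Ts near x; the others lie in a compact set, and
   there joint continuity is enough. *)
Require Import Defs.
From mathcomp Require Import all_boot all_order all_algebra.
From mathcomp Require Import all_classical all_reals all_analysis.
From mathcomp Require Import lra.
Import Order.TTheory GRing.Theory Num.Theory numFieldNormedType.Exports.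
Import ArrowAsProduct.

Set Implicit Arguments.
Unset Strict Implicit.
Unset Printing Implicit Defensive.

Local Open Scope classical_set_scope.
Local Open Scope ring_scope.

(** * Evaluation maps, cluster points and closed conditions *)

Lemma continuous_eval (X Y : topologicalType) (x : X) :
  continuous (fun f : continuousType X Y => f x).
Proof.
move=> f.
apply: (@continuous_comp _ _ _ (fun f : continuousType X Y => (f : X -> Y))
  (@proj X (fun=> Y) x)).
  exact: initial_continuous.
exact: proj_continuous.
Qed.

Lemma cluster_closed (X : topologicalType) (F : set_system X) (A : set X)
    (p : X) :
  closed A -> F A -> cluster F p -> A p.
Proof. by rewrite clusterE => /closure_id clA FA /(_ A FA); rewrite -clA. Qed.

Lemma continuous_dist (R : realType) (Z : topologicalType) (h k : Z -> R) :
  continuous h -> continuous k -> continuous (fun z => `|h z - k z|).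
Proof.
move=> ch ck z.
apply: (@continuous_comp _ _ _ (fun z => h z - k z) (@Num.norm R R)).
  by apply: continuousB; [exact: ch|exact: ck].
exact: norm_continuous.
Qed.

Lemma closed_dist_ge (R : realType) (Z : topologicalType) (h k : Z -> R)
    (e : R) :
  continuous h -> continuous k -> closed [set z | e <= `|h z - k z|].
Proof.
move=> ch ck.
apply: (@preimage_closed _ _ (fun z => `|h z - k z|) [set r | e <= r]).
  by move=> z _; exact: continuous_dist.
exact: closed_ge.
Qed.

Lemma closed_dist_le (R : realType) (Z : topologicalType) (h k : Z -> R)
    (e : R) :
  continuous h -> continuous k -> closed [set z | `|h z - k z| <= e].
Proof.
move=> ch ck.
apply: (@preimage_closed _ _ (fun z => `|h z - k z|) [set r | r <= e]).
  by move=> z _; exact: continuous_dist.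
exact: closed_le.
Qed.

(** * Pointwise compact sets of continuous functions *)

Section pointwise_compact.
Context (R : realType) (X : topologicalType) (K : set (continuousType X R)).
Hypotheses (cX : compact [set: X]) (cK : compact K).

(** One finite set and one tolerance serve all pairs from [K], so failure of this property hands
    over a new pair and a new point at every stage. *)
Let controlled (e : R) (V : set X) := exists s : seq X, exists2 d : R, 0 < d &
  forall f g, K f -> K g -> (forall a, a \in s -> `|f a - g a| <= d) ->
    forall x, V x -> `|f x - g x| <= e.

Lemma controlled_open (U : set X) (e : R) : open U -> U !=set0 -> 0 < e ->
  exists V : set X, [/\ open V, V !=set0, V `<=` U & controlled e V].
Proof.
move=> oU U0 e0; apply: contrapT => noV.
pose C := continuousType X R.
pose ok V := [/\ open V, V !=set0 & V `<=` U].
(* The input holds the current open set, the points chosen so far and the stage. The output is a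
   smaller open set, a point of the current one and a pair from [K], all supplied by the failure of
   [controlled] for these points and the tolerance [n.+1%:R^-1]. *)
have step (p : {V | ok V} * seq X * nat) :
    exists q : {V | ok V} * X * (C * C),
    [/\ K q.2.1, K q.2.2,
      forall a, a \in p.1.2 -> `|q.2.1 a - q.2.2 a| <= p.2.+1%:R^-1,
      sval p.1.1 q.1.2 & sval q.1.1 `<=`
        sval p.1.1 `&` [set x | e < `|q.2.1 x - q.2.2 x|] ].
  case: p => -[[V [oV V0 VU]] s] n /=; apply: contrapT => noq; apply: noV.
  exists V; split=> //; exists s, n.+1%:R^-1; first by rewrite invr_gt0.
  move=> f g Kf Kg fg x Vx; rewrite leNgt; apply/negP => efg; apply: noq.
  pose W := V `&` [set x | e < `|f x - g x|].
  have okW : ok W.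
    split; last by move=> y [/VU].
      apply: openI => //.
      apply: (@open_comp _ _ (fun y => `|f y - g y|) [set r | e < r]).
        by move=> y _; apply: continuous_dist; exact: cts_fun.
      exact: open_gt.
    by exists x.
  by exists (exist _ W okW, x, (f, g)); split => //=; exact: subset_refl.
have [F Fstep] := choice step.
have okU : ok U by split.
pose fix st n := if n is m.+1
  then let q := F (st m, m) in (q.1.1, q.1.2 :: (st m).2)
  else (exist ok U okU, [::]).
pose q n := F (st n, n).
pose V n := sval (st n).1.
have VS n x : V n.+1 x -> V n x /\ e < `|(q n).2.1 x - (q n).2.2 x|.
  by have [_ _ _ _] := Fstep (st n, n); apply.
have Vdecr m n : (m <= n)%N -> V n `<=` V m.
  move=> /subnK <-; elim: (n - m)%N => // k IH; apply: subset_trans IH.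
  by move=> x /VS[].
have mem_st m n : (m < n)%N -> (q m).1.2 \in (st n).2.
  move=> /subnK <-; elim: (n - m.+1)%N => [|k IH]; first by rewrite mem_head.
  by rewrite inE IH orbT.
have Kq n : K (q n).2.1 /\ K (q n).2.2 by have [] := Fstep (st n, n).
have Vq n : V n (q n).1.2 by have [] := Fstep (st n, n).
have close m n : (m < n)%N ->
    `|(q n).2.1 (q m).1.2 - (q n).2.2 (q m).1.2| <= n.+1%:R^-1.
  by move=> /mem_st mn; have [_ _ h _ _] := Fstep (st n, n); exact: h.
have cXKK := compact_setX cX (compact_setX cK cK).
pose u n : X * (C * C) := ((q n).1.2, (q n).2).
have [|[a [f g]] [_ clu]] := cXKK (u @ \oo).
  by exists 0%N => // n _; split => //=; exact: Kq.
(* Evaluation need not be jointly continuous for pointwise convergence, so each passage to the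
   cluster point below moves either the point or the pair of functions, never both. *)
have cfst (h : C) : continuous (fun p : X * (C * C) => h p.1).
  by move=> p; apply: continuous_comp; [exact: cvg_fst|exact: cts_fun].
have cf x : continuous (fun p : X * (C * C) => p.2.1 x).
  move=> p; apply: (@continuous_comp _ _ _
    (fun p : X * (C * C) => p.2.1) (fun h : C => h x)).
    by apply: continuous_comp; [exact: cvg_snd|exact: cvg_fst].
  exact: continuous_eval.
have cg x : continuous (fun p : X * (C * C) => p.2.2 x).
  move=> p; apply: (@continuous_comp _ _ _
    (fun p : X * (C * C) => p.2.2) (fun h : C => h x)).
    by apply: continuous_comp; [exact: cvg_snd|exact: cvg_snd].
  exact: continuous_eval.
(* For [m > n] the point chosen at stage [m] lies in [V n.+1], where the pair of stage [n] differs
   by more than [e]. *)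
have osc_a n : e <= `|(q n).2.1 a - (q n).2.2 a|.
  have cl := @closed_dist_ge _ _ _ _ e (cfst (q n).2.1) (cfst (q n).2.2).
  apply: (cluster_closed cl _ clu).
  exists n.+1 => // m /= nm; apply/ltW.
  by have [] := VS n _ (@Vdecr _ m nm _ (Vq m)).
have eq_q m : f (q m).1.2 = g (q m).1.2.
  apply/eqP; rewrite -subr_eq0 -normr_le0; apply/ler_addgt0Pr => d d0.
  rewrite add0r.
  have cl := @closed_dist_le _ _ _ _ d (cf (q m).1.2) (cg (q m).1.2).
  apply: (cluster_closed cl _ clu).
  change (\forall n \near \oo,
    `|(q n).2.1 (q m).1.2 - (q n).2.2 (q m).1.2| <= d).
  near=> n; apply: (le_trans (@close m n _)).
    by near: n; exact: nbhs_infty_gt.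
  by near: n; apply: filterS (near_infty_natSinv_lt (PosNum d0)) => n /ltW.
have eq_a : f a = g a.
  apply/eqP; rewrite -subr_eq0 -normr_le0.
  apply: (cluster_closed (@closed_dist_le _ _ _ _ 0 (cfst f) (cfst g)) _ clu).
  by exists 0%N => // n _ /=; rewrite eq_q subrr normr0.
have : e <= `|f a - g a|.
  apply: (cluster_closed (@closed_dist_ge _ _ _ _ e (cf a) (cg a)) _ clu).
  by exists 0%N => // n _; exact: osc_a.
by rewrite eq_a subrr normr0 leNgt e0.
Unshelve. all: by end_near. Qed.

(** Members of [K] close to [g] on the finite set [s] are within [e / 3] of [g] on all of [V].
    Continuity of [g] at [x] then gives one neighbourhood for all of them, and compactness of [K]
    reduces to finitely many [g]. *)
Lemma pointwise_compact_equicontinuity_point (U : set X) (e : R) :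
  open U -> U !=set0 -> 0 < e ->
  exists2 x, U x & \forall y \near x, forall f, K f -> `|f x - f y| <= e.
Proof.
move=> oU U0 e0; have e30 : 0 < e / 3 by rewrite divr_gt0.
have [V [oV [x Vx] VU [s [d d0 ctrl]]]] := controlled_open oU U0 e30.
exists x; first exact: VU.
(* The premise [K f] is repeated because the covering property ranges over all [f] near [g], while
   [ctrl] applies only inside [K]. *)
have : \forall y \near x, K `<=` fun f => K f -> `|f x - f y| <= e.
  apply: (iffLR (compact_near_coveringP K) cK X (nbhs x)
    (fun y f => K f -> `|f x - f y| <= e)) => g Kg.
  have near_eval (t : seq X) : \forall f \near g,
      forall a, a \in t -> `|(f : continuousType X R) a - g a| <= d.
    elim: t => [|a t IH].
      by apply: filterS filterT => f _ a; rewrite in_nil.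
    have := @continuous_eval _ _ a g _ (nbhsx_ballx (g a) d d0).
    apply: filterS2 IH => f IH fa b; rewrite inE.
    move=> /predU1P[->|]; last exact: IH.
    by rewrite distrC; apply: ltW.
  have near_x : \forall y \near x, V y /\ `|g x - g y| < e / 3.
    apply: filterI; first exact: open_nbhs_nbhs.
    exact: (@cts_fun _ _ g x _ (nbhsx_ballx (g x) _ e30)).
  near=> f y => /= Kf.
  have [Vy gxy] : V y /\ `|g x - g y| < e / 3 by near: y.
  have fg : forall a, a \in s -> `|f a - g a| <= d.
    by near: f; exact: near_eval.
  have := ctrl _ _ Kf Kg fg _ Vy; have := ctrl _ _ Kf Kg fg _ Vx.
  by move: gxy; rewrite !ler_norml !ltr_norml; lra.
by apply: filterS => y h f Kf; exact: h.
Unshelve. all: by end_near. Qed.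

End pointwise_compact.

(** This is complete regularity of uniform spaces, applied to [x] and the closed complement of the
    interior of [V]. *)
Lemma separating_function (R : realType) (X : uniformType) (x : X) (V : set X) :
  nbhs x V ->
  exists f : continuousType X R, f x = 0 /\ forall y, ~ V y -> f y = 1.
Proof.
move=> /nbhs_interior nV.
have sepV : uniform_separator [set x] (~` V°).
  apply: (@point_uniform_separator R); first exact/open_closedC/open_interior.
  by move=> /(_ (nbhs_singleton nV)).
have [f [cf _ f0 f1]] := iffLR (@uniform_separatorP X R _ _) sepV.
exists (mkcts cf); split => [|y nVy]; first by apply: f0; exists x.
by apply: f1; exists y => //= /interior_subset.
Qed.

(** * Weakly almost periodic semiflows: minimality *)

Section semiflow.
Context (R : realType) (T : topMonoidType) (X : uniformType).
Context (phi : semiflow T X).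
Hypothesis cX : compact [set: X].

Lemma wap_equicontinuity_point (f : continuousType X R) (U : set X) (e : R) :
  weakly_almost_periodic R phi -> open U -> U !=set0 -> 0 < e ->
  exists2 x, U x &
    \forall y \near x, forall t, `|f (phi t x) - f (phi t y)| <= e.
Proof.
move=> /(_ f); rewrite precompactE => cK oU U0 e0.
have [x Ux xP] := pointwise_compact_equicontinuity_point cX cK oU U0 e0.
exists x => //; apply: filterS xP => y yP t.
by apply: (yP (f \o phi t)); apply: subset_closure; exists t.
Qed.

Let translate_continuous (f : continuousType X R) :
  continuous (fun tx : T * X => f (phi tx.1 tx.2)).
Proof.
move=> tx; apply: (@continuous_comp _ _ _ (fun tx : T * X => phi tx.1 tx.2) f).
  exact: act_continuous.
exact: cts_fun.
Qed.

Lemma syndetically_transitive_minimal :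
  syndetically_transitive phi -> weakly_almost_periodic R phi -> minimal phi.
Proof.
move=> st wap x V [v Vv] oV.
have [f [fv f1]] := separating_function R (open_nbhs_nbhs (conj oV Vv)).
(* Oscillation [1/6] against [u] is [1/3] between two points of [U], so [f < 1/3] at one translated
   point forces [f < 2/3] at the other, still below the value [1] taken off [V]. *)
have e0 : 0 < 6^-1 :> R by lra.
have [u _] := wap_equicontinuity_point f wap openT (ex_intro _ v I) e0.
rewrite /prop_near1 nbhsE => -[U [oU Uu] Uosc].
pose V' := [set y | f y < 3^-1].
have oV' : open V'.
  apply: (@open_comp _ _ f [set r | r < 3^-1]) => [y _|]; first exact: cts_fun.
  exact: open_lt.
have V'v : V' v by rewrite /V' /= fv; lra.
have [K cK synd] := st _ _ oU (ex_intro _ u Uu) oV' (ex_intro _ v V'v).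
(* [Z] contains [TU] and is closed because [K] is compact; density of [TU] then makes it all of
   [X]. *)
pose Z := [set y | exists2 k, K k & f (phi k y) <= 2 / 3].
have TUZ t y : U y -> Z (phi t y).
  move=> Uy; have [_ [[k Kk <-] [z [Uz /=]]]] := synd t.
  rewrite /V' /= => fz; exists k => //; rewrite -actM.
  have := Uosc _ Uy (k * t)%g; have := Uosc _ Uz (k * t)%g => /=.
  by rewrite !ler_norml; lra.
have oZ : open (~` Z).
  rewrite openE => y nZy; rewrite /interior.
  have : \forall z \near y, K `<=` fun k => 2 / 3 < f (phi k z).
    apply: (iffLR (compact_near_coveringP K) cK X (nbhs y)
      (fun z k => 2 / 3 < f (phi k z))) => k Kk.
    have lt_fk : 2 / 3 < f (phi k y).
      by rewrite ltNge; apply/negP => fk; apply: nZy; exists k.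
    apply: (@translate_continuous f (k, y) [set r | 2 / 3 < r]).
    by apply: open_nbhs_nbhs; split; first exact: open_gt.
  apply: filterS => z h [k Kk]; rewrite leNgt => /negP; apply; exact: h.
have [k Kk fk] : Z x.
  apply: contrapT => nZx.
  have [L _ syndZ] := st _ _ oU (ex_intro _ u Uu) oZ (ex_intro _ x nZx).
  by have [s [_ [y [Uy]]]] := syndZ 1%g; apply; exact: TUZ.
exists (phi k x); split; last by exists k.
by apply: contrapT => /f1 fe; move: fk; rewrite fe; lra.
Qed.

(** * Equicontinuity, first for functions, then for the uniformity *)

Lemma equicontinuous_compact (f : continuousType X R) (L : set T) (x : X)
    (e : R) :
  compact L -> 0 < e ->
  \forall y \near x, forall t, L t -> `|f (phi t x) - f (phi t y)| <= e.
Proof.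
move=> cL e0.
have : \forall y \near x, L `<=` fun t => `|f (phi t x) - f (phi t y)| < e.
  apply: (iffLR (compact_near_coveringP L) cL X (nbhs x)
    (fun y t => `|f (phi t x) - f (phi t y)| < e)) => k Lk.
  have cd : continuous (fun p : T * X => `|f (phi p.1 x) - f (phi p.1 p.2)|).
    apply: continuous_dist => p.
      apply: (@continuous_comp _ _ _ (fun p : T * X => (p.1, x))
        (fun p : T * X => f (phi p.1 p.2))).
        by apply: cvg_pair; [exact: cvg_fst|exact: cvg_cst].
      exact: translate_continuous.
    exact: translate_continuous.
  apply: (cd (k, x) [set r | r < e]); apply: open_nbhs_nbhs.
  by split; [exact: open_lt|rewrite /= subrr normr0].
by apply: filterS => y h t Lt; exact/ltW/h.
Qed.

Lemma minimal_equicontinuous_function (f : continuousType X R) (x : X) (e : R) :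
  right_C_semigroup T -> weakly_almost_periodic R phi -> minimal phi -> 0 < e ->
  \forall y \near x, forall t, `|f (phi t x) - f (phi t y)| <= e.
Proof.
move=> rC wap mini e0.
have e20 : 0 < e / 2 by lra.
have [u _] := wap_equicontinuity_point f wap openT (ex_intro _ x I) e20.
rewrite /prop_near1 nbhsE => -[W [oW Wu] Wosc].
have [s Wsx] : exists s, W (phi s x).
  have [y [Wy [s _ sxy]]] := mini x _ (ex_intro _ u Wu) oW.
  by exists s; rewrite sxy.
have := rC s; rewrite precompactE; set L := ~` _ => cL.
have nearW' : \forall y \near x, W (phi s y).
  by apply: (@act_continuousr _ _ phi s x); exact: open_nbhs_nbhs.
near=> y => t.
(* If [t = r * s], both [phi s x] and [phi s y] lie in [W], and their translates by [r] are each
   [e / 2]-close to that of [u]. Otherwise [t] lies in the compact closure of [L]. *)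
have [[r _ <-]|nt] := pselect ([set (t * s)%g | t in [set: T]] t).
  rewrite !actM.
  have := Wosc _ Wsx r.
  have Wsy : W (phi s y) by near: y.
  by have := Wosc _ Wsy r; rewrite /= !ler_norml; lra.
have : forall t, closure L t -> `|f (phi t x) - f (phi t y)| <= e.
  by near: y; exact: equicontinuous_compact.
by apply; exact: subset_closure.
Unshelve. all: by end_near. Qed.

(** Separating functions turn small oscillation into membership in an entourage. Compactness of [X]
    is used twice: over the values [phi t x], then over the base points. *)
Lemma equicontinuous_of_functions :
  (forall (f : continuousType X R) x (e : R), 0 < e ->
    \forall y \near x, forall t, `|f (phi t x) - f (phi t y)| <= e) ->
  uniformly_equicontinuous phi.
Proof.
move=> feq.
have cov := iffLR (compact_near_coveringP [set: X]) cX.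
have peq x (E : set (X * X)) : entourage E ->
    \forall y \near x, forall t, E (phi t x, phi t y).
  move=> entE.
  (* The variable [z] stands for the value [phi t x], so that finitely many separating functions
     handle all [t] at once. *)
  have : \forall y \near x, [set: X] `<=`
      fun z => forall t, phi t x = z -> E (phi t x, phi t y).
    apply: cov => z _.
    have nz : nbhs z (xsection (split_ent E) z) by apply: nbhs_entourage.
    have nz' : nbhs z (xsection (split_ent E)^-1%relation z).
      by apply: nbhs_entourage; exact: entourage_inv.
    have [f [fz f1]] := separating_function R nz.
    have nf : \forall z' \near z, f z' < 3^-1 /\ split_ent E (z', z).
      apply: filterI; last by apply: filterS nz' => ? /xsectionP.
      apply: (@cts_fun _ _ f z [set r | r < 3^-1]); apply: open_nbhs_nbhs.
      by split; [exact: open_lt|rewrite /= fz; lra].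
    have nx : \forall y \near x, forall t, `|f (phi t x) - f (phi t y)| <= 3^-1.
      by apply: feq; lra.
    near=> z' y => t tz'.
    have [fz' z'z] : f z' < 3^-1 /\ split_ent E (z', z) by near: z'.
    have zy : xsection (split_ent E) z (phi t y).
      apply: contrapT => /f1 fy.
      have : forall t, `|f (phi t x) - f (phi t y)| <= 3^-1 by near: y.
      by move=> /(_ t); rewrite tz' fy ler_norml; lra.
    by rewrite tz'; apply: (entourage_split z) => //; exact/xsectionP.
  by apply: filterS => y h t; exact: (h (phi t x)).
move=> E entE.
have : \forall q \near entourage, [set: X] `<=`
    fun x => q.1 = x -> forall t, E (phi t q.1, phi t q.2).
  apply: cov => x0 _.
  (* Symmetrizing lets [phi t x0] be the midpoint between the two images. Halving [A] below keeps
     both [x] and [q.2] within [A] of [x0]. *)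
  have := peq x0 _ (entourage_invI (entourage_split_ent entE)).
  rewrite /prop_near1 -nbhs_entourageE => -[A entA x0A].
  near=> x q => /= qx t; rewrite qx.
  have x0x : split_ent A (x0, x).
    by apply/xsectionP; near: x; exact/nbhs_entourage/entourage_split_ent.
  have xq : split_ent A (x, q.2).
    by rewrite -qx -surjective_pairing; near: q; exact: entourage_split_ent.
  have Ax : xsection A x0 x by apply/xsectionP; exact: split_ent_subset x0x.
  have Aq : xsection A x0 q.2.
    by apply/xsectionP; apply: (entourage_split x) => //.
  apply: (entourage_split (phi t x0)) => //.
    by have [] := x0A _ Ax t.
  by have [] := x0A _ Aq t.
move=> entP; exists [set q | forall t, E (phi t q.1, phi t q.2)].
  by apply: filterS entP => q; exact.
by move=> x y xy t; exact: (xy t).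
Unshelve. all: by end_near. Qed.

End semiflow.

Theorem theorem2p30 (R : realType) (T : topMonoidType) (X : uniformType)
    (phi : semiflow T X) :
  compact [set: X] -> hausdorff_space X ->
  right_C_semigroup T ->
  syndetically_transitive phi ->
  weakly_almost_periodic R phi ->
  minimal phi /\ uniformly_equicontinuous phi.
Proof.
move=> cX _ rC st wap.
have mini : minimal phi by exact: (syndetically_transitive_minimal cX st wap).
split=> //; apply: (@equicontinuous_of_functions R) => // f x e e0.
exact: minimal_equicontinuous_function.
Qed.
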